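(* Let $m$ be a positive integer and let $f:\mathbb{Z}_{\geq 0}\to\mathbb{Z}_{\geq 0}$ be an increasing function. Define a sequence $\bar\mu=(\mu_1,\dots,\mu_L)$ of elements of $\mathbb{Z}_{\geq 0}^m$ recursively by $$\mu_1=\max_{\prec}\{\xi\in\mathbb{Z}_{\geq 0}^m:\deg\xi=f(1)\}$$ and, as long as it is possible (i.e. as long as the set below is nonempty), $$\mu_i=\max_{\prec}\{\xi\in\mathbb{Z}_{\geq 0}^m:\deg\xi=f(i)\text{ and }\xi\ngeq\mu_1,\dots,\mu_{i-1}\}.$$ Then the antichain sequence $\bar\mu$ has the maximal length among antichain sequences of $\mathbb{Z}_{\geq 0}^m$ with degree growth bounded by $f$, and so $L=\mathfrak{L}_{f,m}^1$.
   Context: ''Increasing'' means $f(i)\leq f(j)$ whenever $i\leq j$. For $\tau=(\tau_1,\dots,\tau_m)\in\mathbb{Z}_{\geq 0}^m$, $\deg\tau=\tau_1+\cdots+\tau_m$. The symbol $\leq$ on $\mathbb{Z}_{\geq 0}^m$ is the product (coordinatewise) order; $\xi\ngeq\mu_1,\dots,\mu_{i-1}$ means $\xi\ngeq\mu_j$ for every $1\leq j\leq i-1$. The symbol $\prec$ is the degree-lexicographic order: $\tau\prec\eta$ iff $\deg\tau<\deg\eta$, or $\deg\tau=\deg\eta$ and $\tau$ is less than $\eta$ in the lexicographic order (comparison at the first coordinate where they differ). An antichain sequence of $\mathbb{Z}_{\geq 0}^m$ is a finite sequence $a_1,\dots,a_k$ such that $a_i\nleq a_j$ for all $i\neq j$;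 its degree growth is bounded by $f$ if $\deg a_i\leq f(i)$ for all $1\leq i\leq k$. $\mathfrak{L}_{f,m}^1$ denotes the maximal length of an antichain sequence of $\mathbb{Z}_{\geq 0}^m$ with degree growth bounded by $f$. $L$ is the length of $\bar\mu$, the construction stopping at the first index where the set is empty. *)

(* Defs.v *)
From mathcomp Require Import all_boot all_order.
From mathcomp.multinomials Require Export mpoly.

Set Implicit Arguments.
Unset Strict Implicit.
Unset Printing Implicit Defensive.

(* An element of Z_{>=0}^m is a multinom 'X_{1..m}, and [mdeg]
   is its degree.  Two orders live on this type:
   - [(x <= y)%MM] is the product order;
   - [(x <= y)%O] is the degree-lexicographic order: it compares
     [mdeg x :: x] with [mdeg y :: y] lexicographically from the left
     (see [mnmc_le]).
   Sequences are 0-indexed, so entry [i] is the mathematical entry [i.+1]. *)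

Definition is_max d (T : porderType d) (A : T -> Prop) (x : T) : Prop :=
  A x /\ forall y, A y -> (y <= x)%O.

Section AntichainSequences.

Variables (m : nat) (f : nat -> nat).
Implicit Types (s mu : seq 'X_{1..m}) (xi : 'X_{1..m}).

Definition antichain_seq s : Prop :=
  forall i j, i < size s -> j < size s -> i != j ->
    ~~ (nth 0%MM s i <= nth 0%MM s j)%MM.

Definition degree_bounded s : Prop :=
  forall i, i < size s -> mdeg (nth 0%MM s i) <= f i.+1.

Definition bounded_antichain s : Prop :=
  antichain_seq s /\ degree_bounded s.

(* [L] is the number written $\mathfrak{L}_{f,m}^1$. *)
Definition is_max_antichain_length (L : nat) : Prop :=
  is_max (fun n : nat => exists2 s, bounded_antichain s & size s = n) L.

Definition candidate mu (i : nat) xi : Prop :=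
  mdeg xi = f i.+1 /\ forall j, j < i -> ~~ (nth 0%MM mu j <= xi)%MM.

(* The second conjunct says that the recursion stops exactly at the end of
   [mu], i.e. at the first index with no candidate. *)
Definition is_mu_bar mu : Prop :=
  (forall i, i < size mu -> is_max (candidate mu i) (nth 0%MM mu i)) /\
  ~ (exists xi, candidate mu (size mu) xi).

End AntichainSequences.

(* Main.v *)
Require Import Defs.
From mathcomp Require Import all_boot all_order.
From mathcomp Require Import finmap zify.
From Stdlib Require Import ClassicalEpsilon.

(** Identify an exponent vector with a monomial and call the set of all
    products of members of a set with one variable its shadow; it lives one
    degree higher.  Two facts make the greedy sequence [mu] optimal.

    The first is Macaulay's theorem ([macaulay]): among the sets of [n]
    monomials of degree [d], the initial segment made of the [n] largest ones
    in the lexicographic order has the smallest shadow.  Shadows of initial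
    segments are again initial segments ([shadow_initial]), and enlarging an
    initial segment by one element enlarges its shadow by at least one; hence
    the sharper form [macaulay_excess].

    The second is that the degree [d] part of the ideal generated by [mu] is
    an initial segment for every [d] ([mu_bar_ideal_initial]), because each
    entry is the largest monomial of its degree outside the ideal generated by
    the entries before it.

    Let [s] be another bounded antichain, longer than [mu], and cut it to
    [U], its first [(size mu).+1] entries.  Let [u d], [v d] be the numbers of
    monomials of degree [d] in the ideals generated by [U] and by [mu], and
    [a d], [b d] the numbers of entries of [U] and [mu] of degree at most [d].
    The degrees in [mu] are equal to the bounds that those in [U] respect, so
    [b d <= a d].  Passing from [d] to
    [d.+1], the ideal generated by [U] consists of the shadow of its degree [d]
    part and, disjointly because of the antichain condition, of the new
    entries of [U].  Macaulay's theorem then gives [v d + a d <= u d + b d] for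
    all [d], by induction ([ideal_growth]).  In degree [f (size mu).+1] the
    ideal generated by [mu] is everything, since the recursion stopped; so
    [u d <= v d] while [b d <= size mu < a d], a contradiction.

    Macaulay's theorem is proved by compression.  All sets considered are
    contained in a cell: the monomials of a given degree with prescribed
    exponents outside a set [S] of variables, the induction being on the size
    of [S].  Cutting a cell along the exponent of a variable [l] of [S] gives
    cells for [S :\ l]; replacing each slice of [C] by the initial segment of
    the same size ([compress]) does not enlarge the shadow, by induction
    ([shadow_compress]), and strictly decreases the sum of the ranks of the
    elements unless nothing changes ([weight_compress]).  So [C] may be assumed
    fixed by all compressions.  If [q] is the last variable of [S], then the
    shadow of [C] contains the [#|C|] products by [q] and, disjointly, the
    shadow of the slice [C_0] where [q] does not occur ([shadow_lower]); there
    is nothing else when [C] is an initial segment ([shadow_upper]).  It remains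
    to compare the slices [C_0], which is [slice0_le].

    Finally, the recursion defining [mu] stops by Dickson's lemma. *)

Set Implicit Arguments.
Unset Strict Implicit.
Unset Printing Implicit Defensive.

Import Order.TTheory.
Local Open Scope fset_scope.
Local Open Scope nat_scope.

(** * Counting by fibres *)

Section Fibres.
Variables (T : choiceType) (h : T -> nat).
Implicit Types C : {fset T}.

Definition fibre C j : {fset T} := [fset x in C | h x == j].

Lemma in_fibre C j x : (x \in fibre C j) = (x \in C) && (h x == j).
Proof. by rewrite !inE. Qed.

Lemma sum_fibres C N (F : T -> nat) : (forall x, x \in C -> h x < N) ->
  \sum_(x <- C) F x = \sum_(j < N) \sum_(x <- fibre C j) F x.
Proof.
move=> hC; under [RHS]eq_bigr do rewrite big_fset /= big_mkcond.
rewrite exchange_big /= big_seq [RHS]big_seq; apply: eq_bigr => x xC.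
rewrite (bigD1 (Ordinal (hC x xC))) //= eqxx big1 ?addn0 // => j jx.
by case: eqP => // e; case/eqP: jx; apply: val_inj; rewrite /= e.
Qed.

Lemma card_fibres C N : (forall x, x \in C -> h x < N) ->
  #|` C| = \sum_(j < N) #|` fibre C j|.
Proof.
move=> hC; rewrite card_fset_sum1 (sum_fibres _ hC).
by apply: eq_bigr => j _; rewrite card_fset_sum1.
Qed.

End Fibres.

(** * Initial segments of a finite set in a total order *)

Lemma card_lt_fset (T : choiceType) (A B : {fset T}) z :
  A `<=` B -> z \in B -> z \notin A -> #|` A| < #|` B|.
Proof.
move=> AB zB zA; apply: fproper_ltn_card.
by rewrite fproperE AB; apply: contra zA => /fsubsetP; apply.
Qed.

Section InitialSegments.
Variables (disp : Order.disp_t) (T : orderType disp).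
Implicit Types A B C E L : {fset T}.

Definition initial A L : Prop :=
  L `<=` A /\ forall x y, x \in L -> y \in A -> (x <= y)%O -> y \in L.

(** Initial segments of [A] form a chain, so that cardinality decides
    inclusion. *)
Lemma initial_total A L L' :
  initial A L -> initial A L' -> #|` L| <= #|` L'| -> L `<=` L'.
Proof.
move=> [LA Lup] [LA' Lup'] le; apply/fsubsetP => x xL.
apply: contraT => xL'.
have sub : L' `<=` L `\ x.
  apply/fsubsetP => y yL'; rewrite !inE.
  have yx : y != x by apply: contraNneq xL' => <-.
  rewrite yx /=; have [xy|yx'] := leP x y.
    by apply: Lup xL _ xy; apply: (fsubsetP LA').
  by case/negP: xL'; apply: Lup' yL' _ (ltW yx'); apply: (fsubsetP LA).
have := fsubset_leq_card sub; have := cardfsD1 x L; rewrite xL; lia.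
Qed.

Lemma initialU A L L' : initial A L -> initial A L' -> 
  #|` L `|` L'| = maxn #|` L| #|` L'|.
Proof.
move=> iL iL'; case/orP: (leq_total #|` L| #|` L'|) => le.
  by rewrite (maxn_idPr le) (fsetUidPr _ _ (initial_total iL iL' le)).
by rewrite (maxn_idPl le) (fsetUidPl _ _ (initial_total iL' iL le)).
Qed.

(** The position of [x] in the decreasing enumeration of [A], from 0. *)
Definition rank A x := #|` [fset y in A | (x < y)%O]|.

Lemma rank_lt A x y : y \in A -> (x < y)%O -> rank A y < rank A x.
Proof.
move=> yA xy; apply: (@card_lt_fset _ _ _ y).
- by apply/fsubsetP => z; rewrite !inE => /andP[-> /(lt_trans xy)].
- by rewrite !inE yA.
- by rewrite !inE ltxx andbF.
Qed.

Lemma rank_lt_card A x : x \in A -> rank A x < #|` A|.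
Proof.
move=> xA; apply: (@card_lt_fset _ _ _ x) => //; last first.
  by rewrite !inE ltxx andbF.
by apply/fsubsetP => z; rewrite !inE => /andP[].
Qed.

Definition top A n : {fset T} := [fset x in A | rank A x < n].

Lemma in_top A n x : (x \in top A n) = (x \in A) && (rank A x < n).
Proof. by rewrite in_fset. Qed.

Lemma top_initial A n : initial A (top A n).
Proof.
split; first by apply/fsubsetP => x; rewrite !inE => /andP[].
move=> x y; rewrite !inE => /andP[xA xn] yA; rewrite yA /= le_eqVlt.
by case/predU1P => [<- //|/(rank_lt yA) /ltn_trans]; apply.
Qed.

(** [rank A] is injective on [A] with values below [#|A|], hence a bijection
    onto [0, ..., #|A| - 1]; exactly [n] elements have rank below [n]. *)
Lemma card_top A n : n <= #|` A| -> #|` top A n| = n.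
Proof.
move=> nA.
have uA : uniq [seq rank A x | x <- A].
  rewrite map_inj_in_uniq ?fset_uniq // => x y xA yA exy.
  apply/eqP; apply: contraT.
  by case: ltgtP => [/(rank_lt yA)|/(rank_lt xA)|//] //; rewrite exy ltnn.
have pA : perm_eq [seq rank A x | x <- A] (iota 0 #|` A|).
  apply: uniq_perm => //; first exact: iota_uniq.
  apply: (uniq_min_size uA _ _).2; last by rewrite size_iota size_map.
  by move=> _ /mapP[x xA ->]; rewrite mem_iota /= rank_lt_card.
rewrite card_fset_sum1 big_fset /= sum1_count.
rewrite -(count_map (rank A) (fun k => k < n)) (permP pA) -size_filter.
rewrite -{2}[n]subn0 -[in RHS](size_iota 0 (n-0)); congr size.
rewrite -[#|` A|](subnKC nA) iotaD filter_cat subn0 add0n.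
rewrite (all_filterP _); last by apply/allP => k; rewrite mem_iota.
rewrite -[RHS]cats0; congr cat; apply/eqP; rewrite -[_ == _]negbK -has_filter.
by apply/hasPn => k; rewrite mem_iota -leqNgt => /andP[].
Qed.

Lemma sum_lt (E B : {fset T}) (F : T -> nat) :
    #|` E| = #|` B| -> (forall x y, x \in E -> y \in B -> F x < F y) ->
  \sum_(x <- E) F x + #|` E| <= \sum_(x <- B) F x.
Proof.
move=> eEB EB; pose r := \max_(x <- E) F x.
have le1 : \sum_(x <- E) F x <= #|` E| * r.
  rewrite card_fset_sum1 big_distrl /= big_seq [X in _ <= X]big_seq.
  by apply: leq_sum => x xE; rewrite mul1n; apply: leq_bigmax_seq.
have le2 : #|` E| * r.+1 <= \sum_(x <- B) F x.
  have [->|[z zE]] := fset_0Vmem E; first by rewrite cardfs0.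
  rewrite eEB card_fset_sum1 big_distrl /= big_seq [X in _ <= X]big_seq.
  apply: leq_sum => y yB; rewrite mul1n.
  rewrite /r big_seq; apply big_ind => [|u v|x xE].
  - by apply: leq_trans (EB _ _ zE yB).
  - by rewrite /maxn; case: ifP.
  - exact: EB.
by apply: leq_trans le2; rewrite mulnS addnC leq_add2l.
Qed.

(** For a decreasing weight, an initial segment is the lightest subset of its
    size: it differs from [C] by exchanging elements of [C] for as many larger,
    hence strictly lighter, ones.  The term [#|L `\` C|] records that each
    exchange gains at least 1. *)
Lemma sum_initial_le A C L (F : T -> nat) :
    (forall x y, y \in A -> (x < y)%O -> F y < F x) ->
    C `<=` A -> initial A L -> #|` L| = #|` C| ->
  \sum_(x <- L) F x + #|` L `\` C| <= \sum_(x <- C) F x.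
Proof.
move=> Fdec CA [LA Lup] eLC.
have split2 (X Y : {fset T}) : \sum_(x <- X) F x =
    (\sum_(x <- X `&` Y) F x + \sum_(x <- X `\` Y) F x)%N.
  rewrite (big_fsetID _ (mem Y)) /=; congr (_ + _); apply: eq_fbigl => x;
  by rewrite !inE // andbC.
rewrite (split2 L C) (split2 C L) fsetIC -addnA leq_add2l.
apply: sum_lt; first by rewrite !cardfsD eLC fsetIC.
move=> x y; rewrite !inE => /andP[xC xL] /andP[yL yC].
apply: Fdec; first exact: (fsubsetP LA).
rewrite ltNge; apply: contra yL => xy; apply: Lup xL _ xy.
exact: (fsubsetP CA).
Qed.

End InitialSegments.

(** * Cells and shadows *)

Section Monomials.
Variable m : nat.
Implicit Types (S : {set 'I_m}) (x y z b : 'X_{1..m}) (C L : {fset 'X_{1..m}}).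
Implicit Types (i l p q : 'I_m) (d j : nat).

Definition agree_off S x y := forall i, i \notin S -> x i = y i.

(** Keeping the ambient number [m] of variables and shrinking [S] makes slices
    of cells literally cells, with the order inherited from ['X_{1..m}]. *)
Definition cell S b d : {fset 'X_{1..m}} :=
  [fset bmnm x | x in [pred x : 'X_{1..m < d.+1} |
     (mdeg x == d) && [forall i, (i \notin S) ==> (x i == b i)]]].

Lemma cellP S b d x :
  reflect (mdeg x = d /\ agree_off S x b) (x \in cell S b d).
Proof.
apply: (iffP (imfsetP _ _ _ _)) => /=
  [[y /andP[/eqP dy /forallP ay] ->]|[dx ax]].
  by split=> // i iS; apply/eqP; have /implyP := ay i; apply.
have lt : mdeg x < d.+1 by rewrite dx.
exists (BMultinom lt) => //=; apply/andP; split; first exact/eqP.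
by apply/forallP => i; apply/implyP => /ax ->.
Qed.

Definition shadow S C : {fset 'X_{1..m}} :=
  \bigcup_(i in S) [fset (x + U_(i))%MM | x in C].

Lemma shadowP S C x :
  reflect (exists2 y, y \in C & exists2 i, i \in S & x = (y + U_(i))%MM)
          (x \in shadow S C).
Proof.
apply: (iffP (bigfcupP _ _ _ _)).
  by case=> i /andP[_ iS] /imfsetP[y /= yC ->]; exists y => //; exists i.
case=> y yC [i iS ->]; exists i; first by rewrite mem_index_enum.
by apply/imfsetP; exists y.
Qed.

Lemma shadowS S C L : L `<=` C -> shadow S L `<=` shadow S C.
Proof.
move=> LC; apply/fsubsetP => x /shadowP[y yL [i iS ->]].
by apply/shadowP; exists y; [apply: (fsubsetP LC)|exists i].
Qed.

Definition translate l C : {fset 'X_{1..m}} := [fset (x + U_(l))%MM | x in C].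

Lemma card_translate l C : #|` translate l C| = #|` C|.
Proof. by rewrite card_imfset //; apply: addIm. Qed.

Lemma mnmD1 x l i : (x + U_(l))%MM i = x i + (l == i).
Proof. by rewrite mnmDE mnm1E. Qed.

Lemma mdegD1 x l : mdeg (x + U_(l)) = (mdeg x).+1.
Proof. by rewrite mdegD mdeg1 addn1. Qed.

Lemma mnm_subK x l : 0 < x l -> exists y, x = (y + U_(l))%MM.
Proof.
by move=> xl; exists (x - U_(l))%MM; rewrite submK // lep1mP -lt0n.
Qed.

Lemma mnm_shift_lt l i x : l < i -> ((x + U_(i))%MM < (x + U_(l))%MM)%O.
Proof.
move=> li; rewrite ltmc_add2r; apply/ltmcP; first by rewrite !mdeg1.
exists l.
  by move=> j jl; rewrite !mnm1E; do 2 case: eqP => // ?; subst; lia.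
by rewrite !mnm1E eqxx; case: eqP => // e; subst; rewrite ltnn in li.
Qed.

Lemma mnm_shift_le l i x : l <= i -> ((x + U_(i))%MM <= (x + U_(l))%MM)%O.
Proof.
rewrite leq_eqVlt => /predU1P[/val_inj -> //|/mnm_shift_lt/ltW]; exact.
Qed.

Lemma ltmc_onP S x y : mdeg x = mdeg y -> agree_off S x y ->
    (x < y)%O ->
  exists i, [/\ i \in S, forall k : 'I_m, k < i -> x k = y k & x i < y i].
Proof.
move=> dxy axy /(ltmcP dxy)[i eqi lti]; exists i; split=> //.
by apply: contraT => /axy e; rewrite e ltnn in lti.
Qed.

Lemma ord_neq (t k : 'I_m) : k < t -> (t == k) = false.
Proof. by move=> kt; apply/eqP => e; rewrite e ltnn in kt. Qed.

(** A strict inequality before [i] would decide the lexicographic comparison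
    in the same direction. *)
Lemma ltmc_le x y i :
    mdeg x = mdeg y -> (forall k : 'I_m, k < i -> x k <= y k) -> x i < y i ->
  (x < y)%O.
Proof.
move=> dxy le lt; rewrite ltNge le_eqVlt; apply/negP => /predU1P[e|].
  by rewrite e ltnn in lt.
case/(ltmcP (esym dxy)) => h eqh lth.
have [hi|ih|/val_inj e] := ltngtP h i.
- by have := le h hi; rewrite leqNgt lth.
- by rewrite (eqh i ih) ltnn in lt.
- by subst h; have := ltn_trans lt lth; rewrite ltnn.
Qed.

Lemma leq_mdeg x y : (forall i, x i <= y i) -> mdeg x = mdeg y -> x = y.
Proof.
move=> le; have /submK e : (x <= y)%MM by apply/mnm_lepP.
rewrite -{1}e mdegD => /eqP.
rewrite -{1}[mdeg x]add0n eqn_add2r eq_sym mdeg_eq0.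
by move=> /eqP e0; rewrite -e e0 add0m.
Qed.

Definition setcoord b l j : 'X_{1..m} :=
  [multinom (if i == l then j else b i) | i < m].

Lemma setcoordE b l j i : setcoord b l j i = if i == l then j else b i.
Proof. by rewrite mnmE. Qed.

Lemma fibre_cell S b d l j : l \in S ->
  fibre (fun x => x l) (cell S b d) j = cell (S :\ l) (setcoord b l j) d.
Proof.
move=> lS; apply/fsetP => x; rewrite in_fibre; apply/andP/cellP.
  case=> /cellP[dx ax] /eqP xl; split=> // i; rewrite setcoordE !inE.
  by case: eqP => [-> _|_ /= /ax].
case=> dx ax; split; last by rewrite ax ?setcoordE ?eqxx // !inE eqxx.
apply/cellP; split=> // i iS; rewrite ax ?setcoordE ?inE ?(negbTE iS) ?andbF //.
by case: eqP iS => // ->; rewrite lS.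
Qed.

(** Let [w = x + U_(i)] with [x] in [L], and [w <= v].  Dividing [v] by its
    last variable [t] in [S] gives [u], and [u] is in [L] because [x <= u]:
    otherwise [u] and [x] first differ at some [h] with [u h < x h].  If
    [h < t], this makes [v < w]; if [t < h], then [u] vanishes on [S] after
    [t], so [u] has smaller degree than [x]; if [h = t], then [v <= w]
    coordinatewise, so [v = w], and the exponents of [u + U_(t) = x + U_(i)]
    at [i] cannot match. *)
Lemma shadow_initial S b d L :
  initial (cell S b d) L -> initial (cell S b d.+1) (shadow S L).
Proof.
case=> Lc Lup; split.
  apply/fsubsetP => _ /shadowP[x /(fsubsetP Lc) /cellP[dx ax] [i iS ->]].
  apply/cellP; split; first by rewrite mdegD1 dx.
  by move=> k kS; rewrite mnmD1 ax //; case: eqP kS => [<-|]; rewrite ?iS ?addn0.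
move=> w v /shadowP[x xL [i iS ew]] /cellP[dv av] wv.
have /cellP[dx ax] := fsubsetP Lc _ xL.
have vS : exists t, (t \in S) && (0 < v t).
  apply/existsP; rewrite -[[exists _, _]]negbK negb_exists.
  apply/negP => /forallP h.
  have : mdeg v <= mdeg x.
    rewrite !mdegE; apply: leq_sum => k _.
    have := h k; rewrite negb_and -leqNgt leqn0.
    by case: (boolP (k \in S)) => [_ /= /eqP -> //|kS _]; rewrite av // ax.
  by rewrite dv dx ltnn.
case: vS => t0 vt0.
have [t /andP[tS vt] tmax] :=
  @arg_maxnP _ t0 [pred t | (t \in S) && (0 < v t)] (@nat_of_ord m) vt0.
have v0 k : k \in S -> t < k -> v k = 0.
  move=> kS tk; apply/eqP; rewrite -leqn0 leqNgt; apply/negP => vk.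
  by have := tmax k; rewrite /= kS vk => /(_ isT); lia.
have [u ev] := mnm_subK vt.
have uE k : v k = u k + (t == k) by rewrite ev mnmD1.
have du : mdeg u = d by move: dv; rewrite ev mdegD1 => -[].
have au : agree_off S u b.
  move=> k kS; have := uE k; rewrite av //.
  by case: eqP kS => [<-|]; rewrite ?tS ?addn0.
apply/shadowP; exists u; last by exists t.
apply: (Lup x) => //; first exact/cellP.
rewrite leNgt; apply/negP => ux.
have [h [hS eqh lth]] : exists h,
    [/\ h \in S, forall k : 'I_m, k < h -> u k = x k & u h < x h].
  apply: ltmc_onP ux; first by rewrite du dx.
  by move=> k kS; rewrite au // ax.
have wE k : w k = x k + (i == k) by rewrite ew mnmD1.
have dvw : mdeg v = mdeg w by rewrite dv ew mdegD1 dx.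
have [ht|th|eht] := ltngtP h t.
- suff vw : (v < w)%O by rewrite ltNge wv in vw.
  apply: (@ltmc_le _ _ h) => [//|k kh|].
    by rewrite uE wE (eqh k kh) (ord_neq (ltn_trans kh ht)) addn0 leq_addr.
  by rewrite uE wE (ord_neq ht) addn0 ltn_addr.
- suff : mdeg u < mdeg x by rewrite du dx ltnn.
  rewrite !mdegE (bigD1 h) //= [X in _ < X](bigD1 h) //= -addSn.
  apply: leq_add => //.
  apply: leq_sum => k kh.
  have [kh'|hk|/val_inj e] := ltngtP k h; first by rewrite eqh.
    have [kS|kS] := boolP (k \in S); last by rewrite au // ax.
    move: (uE k); rewrite (v0 k kS (ltn_trans th hk)) => /esym/eqP.
    by rewrite addn_eq0 => /andP[/eqP -> _].
  by rewrite e eqxx in kh.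
- move/val_inj: eht => eht; subst h.
  have vlew k : v k <= w k.
    have [kt|tk|/val_inj e] := ltngtP k t.
    - by rewrite uE wE (eqh k kt) (ord_neq kt) addn0 leq_addr.
    - have [kS|kS] := boolP (k \in S); first by rewrite v0.
      by rewrite av // wE ax // leq_addr.
    - by subst k; have := uE t; rewrite eqxx wE; lia.
  have e := leq_mdeg vlew dvw.
  have := uE i; have := wE i; rewrite -e eqxx.
  have [it|ti|/val_inj eit] := ltngtP i t.
  - by rewrite (uE i) (eqh i it) (ord_neq it); lia.
  - by rewrite (v0 i iS ti); lia.
  - by subst i; rewrite eqxx; lia.
Qed.


(** * Slices along a variable, and compression *)

Notation slice l C j := (fibre (fun x : 'X_{1..m} => x l) C j).

Lemma shadow_sub S b d C : C `<=` cell S b d -> shadow S C `<=` cell S b d.+1.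
Proof.
move=> Cc; apply/fsubsetP => _ /shadowP[x xC [i iS ->]].
have /cellP[dx ax] := fsubsetP Cc _ xC.
apply/cellP; split; first by rewrite mdegD1 dx.
by move=> k kS; rewrite mnmD1 ax //; case: eqP kS => [<-|]; rewrite ?iS ?addn0.
Qed.

Lemma mnm_le_mdeg x l : x l <= mdeg x.
Proof. by rewrite mdegE (bigD1 l) //= leq_addr. Qed.

Lemma cell_lt S b d l x : x \in cell S b d -> x l < d.+1.
Proof. by case/cellP => <- _; rewrite ltnS mnm_le_mdeg. Qed.

Lemma slice_sub S b d l j C : l \in S -> C `<=` cell S b d ->
  slice l C j `<=` cell (S :\ l) (setcoord b l j) d.
Proof.
move=> lS /fsubsetP Cc; rewrite -fibre_cell //; apply/fsubsetP => x.
by rewrite !in_fibre => /andP[/Cc -> ->].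
Qed.

Lemma slice_initial S b d l j L : l \in S -> initial (cell S b d) L ->
  initial (cell (S :\ l) (setcoord b l j) d) (slice l L j).
Proof.
move=> lS [Lc Lup]; split; first exact: slice_sub.
move=> x y; rewrite in_fibre => /andP[xL _].
rewrite -fibre_cell // !in_fibre => /andP[yc ->] xy; rewrite andbT.
exact: Lup xy.
Qed.

(** Splitting a shadow along the exponent of [l]: multiplying by a variable
    other than [l] stays in the slice, multiplying by [l] moves up one
    slice. *)
Lemma slice_shadow0 S l C : l \in S ->
  slice l (shadow S C) 0 = shadow (S :\ l) (slice l C 0).
Proof.
move=> lS; apply/fsetP => x; rewrite in_fibre; apply/andP/shadowP.
  case=> /shadowP[y yC [i iS ->]]; rewrite mnmD1 addn_eq0 eqb0 => /andP[yl il].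
  by exists y; [rewrite in_fibre yC|exists i; rewrite // !inE il].
case=> y; rewrite in_fibre => /andP[yC /eqP yl] [i].
rewrite !inE => /andP[il iS] ->.
rewrite mnmD1 yl (negbTE il); split=> //.
by apply/shadowP; exists y => //; exists i.
Qed.

Lemma slice_shadowS S l C j : l \in S ->
  slice l (shadow S C) j.+1 =
  shadow (S :\ l) (slice l C j.+1) `|` translate l (slice l C j).
Proof.
move=> lS; apply/fsetP => x; rewrite in_fibre in_fsetU; apply/andP/orP.
  case=> /shadowP[y yC [i iS ->]]; rewrite mnmD1.
  case: (eqVneq i l) => [->|il].
    rewrite addn1 eqSS => yl; right; apply/imfsetP; exists y => //=.
    by rewrite in_fibre yC.
  rewrite addn0 => yl; left; apply/shadowP.
  by exists y; [rewrite in_fibre yC|exists i; rewrite // !inE il].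
case.
  case/shadowP => y; rewrite in_fibre => /andP[yC /eqP yl] [i].
  rewrite !inE => /andP[il iS] ->; rewrite mnmD1 yl (negbTE il) addn0 eqxx.
  by split=> //; apply/shadowP; exists y => //; exists i.
case/imfsetP => y /=; rewrite in_fibre => /andP[yC /eqP yl] ->.
rewrite mnmD1 yl eqxx addn1; split=> //.
by apply/shadowP; exists y => //; exists l.
Qed.

Lemma translate_initial S b d l j L : l \notin S -> 
  initial (cell S (setcoord b l j) d) L ->
  initial (cell S (setcoord b l j.+1) d.+1) (translate l L).
Proof.
move=> lS [Lc Lup]; split.
  apply/fsubsetP => _ /imfsetP[x /(fsubsetP Lc) /cellP[dx ax] ->] /=.
  apply/cellP; rewrite mdegD1 dx; split=> // i iS.
  by rewrite mnmD1 ax // !setcoordE eq_sym; case: eqP => _; rewrite ?addn0 ?addn1.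
move=> _ y /imfsetP[x /= xL ->] /cellP[dy ay].
have [u eu] : exists u, y = (u + U_(l))%MM.
  by apply: mnm_subK; rewrite ay // setcoordE eqxx.
rewrite eu ![(_ + U_(l))%MM]addmC lemc_add2r => xu.
apply/imfsetP; exists u; last by rewrite addmC.
apply: Lup xL _ xu; apply/cellP; split.
  by move: dy; rewrite eu mdegD1 => -[].
move=> i iS; have := ay i iS; rewrite eu mnmD1 !setcoordE eq_sym.
by case: eqP; rewrite ?addn0 ?addn1 // => _ [].
Qed.

(** Macaulay's theorem for the variables in [S], as an induction
    hypothesis. *)
Definition macaulay_at S : Prop := forall b d C L,
  C `<=` cell S b d -> initial (cell S b d) L -> #|` L| <= #|` C| ->
  #|` shadow S L| <= #|` shadow S C|.

Section Compression.
Variables (S : {set 'I_m}) (b : 'X_{1..m}) (d : nat) (l : 'I_m).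
Hypothesis lS : l \in S.
Let A := cell S b d.

(** Each slice of [C] along [l] is replaced by the initial segment, of the same
    size, of the corresponding slice of the cell. *)
Definition compress C : {fset 'X_{1..m}} :=
  [fset x in A | x \in top (slice l A (x l)) #|` slice l C (x l)|].

Lemma in_compress C x : (x \in compress C) =
  (x \in A) && (x \in top (slice l A (x l)) #|` slice l C (x l)|).
Proof. by rewrite in_fset. Qed.

Lemma compress_sub C : compress C `<=` A.
Proof. by apply/fsubsetP => x; rewrite !inE => /andP[]. Qed.

Lemma slice_compress C j :
  slice l (compress C) j = top (slice l A j) #|` slice l C j|.
Proof.
apply/fsetP => x; rewrite in_fibre in_compress; apply/andP/idP.
  by case=> /andP[_ h] /eqP <-.
move=> h; have := h; rewrite in_top in_fibre => /andP[/andP[xA /eqP xj] _].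
by rewrite xA xj eqxx h.
Qed.

Lemma card_slice_compress C j : C `<=` A ->
  #|` slice l (compress C) j| = #|` slice l C j|.
Proof.
move=> CA; rewrite slice_compress card_top //; apply: fsubset_leq_card.
by rewrite [X in _ `<=` X]fibre_cell //; apply: slice_sub.
Qed.

Lemma slice_compress_initial C j :
  initial (cell (S :\ l) (setcoord b l j) d) (slice l (compress C) j).
Proof. by rewrite slice_compress -fibre_cell //; apply: top_initial. Qed.

Lemma card_compress C : C `<=` A -> #|` compress C| = #|` C|.
Proof.
move=> CA; rewrite !(@card_fibres _ (fun x => x l) _ d.+1).
- by apply: eq_bigr => j _; rewrite card_slice_compress.
- by move=> x /(fsubsetP CA) /cell_lt.
- by move=> x /(fsubsetP (compress_sub C)) /cell_lt.
Qed.

(** By [slice_shadowS], a slice of a shadow is a union of the shadow of a slice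
    and of a translate.  After compression both are initial segments of the
    same cell, so their union is as small as the larger of the two, and each
    is no larger than its counterpart for [C]. *)
Lemma shadow_compress C : macaulay_at (S :\ l) -> C `<=` A ->
  #|` shadow S (compress C)| <= #|` shadow S C|.
Proof.
move=> IH CA; rewrite !(@card_fibres _ (fun x => x l) _ d.+2).
- apply: leq_sum => -[[|j] /= _] _.
    rewrite !slice_shadow0 //; apply: IH (slice_compress_initial C 0) _.
      exact: slice_sub CA.
    by rewrite card_slice_compress.
  pose B := cell (S :\ l) (setcoord b l j.+1) d.+1.
  rewrite !slice_shadowS // (@initialU _ _ B).
  + rewrite geq_max card_translate card_slice_compress // -(card_translate l) .
    rewrite (fsubset_leq_card (fsubsetUr _ _)) andbT.
    apply: leq_trans (fsubset_leq_card (fsubsetUl _ _)).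
    apply: IH (slice_compress_initial C j.+1) _; first exact: slice_sub CA.
    by rewrite card_slice_compress.
  + exact: shadow_initial (slice_compress_initial _ _).
  + apply: translate_initial; first by rewrite !inE eqxx.
    exact: slice_compress_initial.
- by move=> x /(fsubsetP (shadow_sub CA)) /cell_lt.
- by move=> x /(fsubsetP (shadow_sub (compress_sub C))) /cell_lt.
Qed.

(** The sum of the ranks is the measure showing that repeated compression
    ends. *)
Lemma weight_compress C : C `<=` A ->
  \sum_(x <- compress C) rank A x + #|` compress C `\` C|
    <= \sum_(x <- C) rank A x.
Proof.
move=> CA.
rewrite !(@sum_fibres _ (fun x => x l) _ d.+1).
rewrite ?(@card_fibres _ (fun x => x l) _ d.+1).
- rewrite -big_split; apply: leq_sum => j _ /=.
  have -> : slice l (compress C `\` C) j =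
      slice l (compress C) j `\` slice l C j.
    apply/fsetP => x; rewrite in_fsetD !in_fibre in_fsetD.
    by case: (x l == j); rewrite ?andbF ?andbT.
  apply: (@sum_initial_le _ _ (slice l A j)).
  + move=> x y yA; apply: rank_lt.
    by move: yA; rewrite in_fibre => /andP[].
  + by rewrite [X in _ `<=` X]fibre_cell //; apply: slice_sub.
  + by rewrite [X in initial X]fibre_cell //; apply: slice_compress_initial.
  + exact: card_slice_compress.
- by move=> x; rewrite inE => /andP[_ /(fsubsetP (compress_sub C)) /cell_lt].
- by move=> x /(fsubsetP CA) /cell_lt.
- by move=> x /(fsubsetP (compress_sub C)) /cell_lt.
Qed.

(** A set fixed by compression along [l] is stable under moves upwards in the
    cell that keep the exponent of [l]. *)
Lemma compress_fixed C x y : compress C = C -> x \in C -> y \in A ->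
  x l = y l -> (x <= y)%O -> y \in C.
Proof.
move=> fixC xC yA xyl xy.
have [_ up] := slice_compress_initial C (x l).
have : y \in slice l (compress C) (x l).
  apply: up xy; first by rewrite in_fibre fixC xC eqxx.
  by rewrite -fibre_cell // in_fibre yA xyl eqxx.
by rewrite in_fibre fixC => /andP[].
Qed.

End Compression.

(** * Macaulay's theorem *)

(** The elements divisible by [q] include [translate q C]; the others form the
    shadow of the slice of exponent 0. *)
Lemma shadow_lower S q C : q \in S ->
  #|` C| + #|` shadow (S :\ q) (slice q C 0)| <= #|` shadow S C|.
Proof.
move=> qS; rewrite -(card_translate q C) -cardfsUI.
have -> : translate q C `&` shadow (S :\ q) (slice q C 0) = fset0.
  apply/fsetP => x; rewrite in_fset0 in_fsetI; apply/negP => /andP[].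
  case/imfsetP=> y _ ->.
  by rewrite -slice_shadow0 // in_fibre mnmD1 eqxx addn1 andbF.
rewrite cardfs0 addn0.
apply: fsubset_leq_card; apply/fsubsetP => x; rewrite in_fsetU => /orP[].
  by case/imfsetP => y /= yC ->; apply/shadowP; exists y => //; exists q.
by rewrite -slice_shadow0 // in_fibre => /andP[].
Qed.

(** Equality in [shadow_lower] for initial segments: if [u + U_(q)] lies in the
    shadow, it equals some [y + U_(i)] with [y] in [L], which is at least
    [y + U_(q)] as [q] comes last, so that [y <= u] and [u] is in [L]. *)
Lemma shadow_upper S b d q L : q \in S -> (forall i, i \in S -> i <= q) ->
    initial (cell S b d) L ->
  #|` shadow S L| <= #|` L| + #|` shadow (S :\ q) (slice q L 0)|.
Proof.
move=> qS qmax [Lc Lup]; rewrite -(card_translate q L).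
set B := shadow _ (slice _ _ _).
suff sub : shadow S L `<=` translate q L `|` B.
  by apply: leq_trans (fsubset_leq_card sub) _; rewrite cardfsU leq_subr.
rewrite {}/B.
apply/fsubsetP => x xs; rewrite in_fsetU -slice_shadow0 // in_fibre xs /=.
rewrite orbC; have [//|xq] := posnP (x q); apply/imfsetP.
have [u eu] := mnm_subK xq; exists u => //=.
have /cellP[dx ax] := fsubsetP (shadow_sub Lc) _ xs.
case/shadowP: xs => y yL [i iS ey]; apply: Lup yL _ _.
  apply/cellP; split; first by move: dx; rewrite eu mdegD1 => -[].
  move=> k kS; rewrite -ax // eu mnmD1.
  by case: eqP kS => [<-|_ _]; rewrite ?qS ?addn0.
have := mnm_shift_le y (qmax i iS).
by rewrite -[(y + U_(i))%MM]ey eu ![(_ + U_(q))%MM]addmC lemc_add2r.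
Qed.

(** Total, with the junk value 0 on the empty set, so that it can be
    iterated. *)
Definition greatest C : 'X_{1..m} := head 0%MM (top C 1).

Lemma greatestP C : C != fset0 ->
  greatest C \in C /\ forall y, y \in C -> (y <= greatest C)%O.
Proof.
rewrite -cardfs_gt0 => C1; have cT := card_top C1.
have : greatest C \in top C 1.
  have mem_hd (s : seq 'X_{1..m}) : size s = 1 -> head 0%MM s \in s.
    by case: s => // x s _; exact: mem_head.
  exact: mem_hd cT.
rewrite in_top ltnS leqn0 cardfs_eq0 => /andP[zC /eqP e]; split=> // y yC.
rewrite leNgt; apply/negP => zy.
by have := in_fset0 y; rewrite -e !inE yC zy.
Qed.

Lemma set_maximum S :
  S != set0 -> exists2 q, q \in S & forall i, i \in S -> i <= q.
Proof.
case/set0Pn => i0 iS.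
have [q qS qmax] := @arg_maxnP _ i0 (mem S) (@nat_of_ord m) iS.
by exists q => // i /qmax.
Qed.

(** With a single free variable, the degree determines the monomial. *)
Lemma cell_small S b d : #|S| <= 1 -> #|` cell S b d| <= 1.
Proof.
move=> S1; have eqc x y : x \in cell S b d -> y \in cell S b d -> ~~ (x < y)%O.
  move=> /cellP[dx ax] /cellP[dy ay]; apply/negP => xy.
  have dxy : mdeg x = mdeg y by rewrite dx.
  have axy : agree_off S x y by move=> i iS; rewrite ax ?ay.
  have [i [iS _ lt]] := ltmc_onP dxy axy xy.
  suff e : x = y by rewrite e ltxx in xy.
  apply: leq_mdeg => // k; have [kS|/axy -> //] := boolP (k \in S).
  have -> : k = i by apply: (card_le1_eqP S1).
  exact: ltnW.
have [->|[x xc]] := fset_0Vmem (cell S b d); first by rewrite cardfs0.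
rewrite -(cardfs1 x); apply: fsubset_leq_card; apply/fsubsetP => y yc.
by rewrite in_fset1; have := eqc _ _ xc yc; have := eqc _ _ yc xc; case: ltgtP.
Qed.

(** If [z] is the greatest element of [C], then [z + U_(p)] exceeds every
    element of [translate q C].  This settles the case of two variables, where
    no third variable is available to compress along. *)
Lemma shadow_grows S p q C : p \in S -> q \in S -> p < q -> C != fset0 ->
  #|` C| < #|` shadow S C|.
Proof.
move=> pS qS pq /greatestP[]; set z := greatest C => zC zmax.
rewrite -(card_translate q C).
apply: (@card_lt_fset _ _ _ (z + U_(p))%MM).
- apply/fsubsetP => _ /imfsetP[x /= xC ->].
  by apply/shadowP; exists x => //; exists q.
- by apply/shadowP; exists z => //; exists p.
apply/negP => /imfsetP[y /= /zmax yz e].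
have := mnm_shift_lt z pq; rewrite e ![(_ + U_(q))%MM]addmC ltmc_add2r.
by rewrite ltNge yz.
Qed.

(** [y] arises from [x] by turning every factor [q] into the earlier variable
    [p]. *)
Lemma move_exponent p q x : p < q -> exists y,
  [/\ mdeg y = mdeg x, forall i, i != p -> i != q -> y i = x i,
      y q = 0 & (x <= y)%O].
Proof.
move=> pq; pose n := x q; pose r := (x - U_(q) *+ n)%MM.
have npq : (p == q) = false by apply/eqP => e; rewrite e ltnn in pq.
have er : x = (r + U_(q) *+ n)%MM.
  rewrite submK //; apply/mnm_lepP => i; rewrite mulmnE mnm1E.
  by case: eqP => [<-|_]; rewrite ?mul1n.
exists (r + U_(p) *+ n)%MM.
have dE : mdeg (r + U_(p) *+ n) = mdeg x by rewrite er !mdegD !mdegMn !mdeg1.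
have yE i : (r + U_(p) *+ n)%MM i = r i + (p == i) * n.
  by rewrite mnmDE mulmnE mnm1E.
have rE i : x i = r i + (q == i) * n by rewrite {1}er mnmDE mulmnE mnm1E.
have rq : r q = 0 by have := rE q; rewrite eqxx mul1n -/n; lia.
split=> //.
- by move=> i ip iq; rewrite yE rE ![_ == i]eq_sym (negbTE ip) (negbTE iq).
- by rewrite yE npq rq.
have [n0|n0] := posnP n; first by rewrite {1}er n0 !mulm0n lexx.
apply/ltW/(ltmc_le (i := p)) => // [k kp|].
  rewrite yE rE; suff -> : (q == k) = false by rewrite addn0 leq_addr.
  by apply/eqP => e; subst k; lia.
by rewrite yE rE eqxx [q == p]eq_sym npq; lia.
Qed.

(** Suppose that the slice [C_0] of [C] is smaller than that of [L]; both being
    initial, some [z] in [L_0] is missing from [C_0], and all of [C_0] lies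
    above [z].  Given [y] in [C], move its exponent at [q] to [p], the last
    variable but one: the result [y'] is still in [C], by compression along a
    third variable [l], so [y'] is in [C_0] and [z < y'].  These two agree at
    [q] and have the same degree, so they first differ strictly before [p],
    where [y] and [y'] coincide.  Hence [z < y], and [y] is in [L].  Thus [C]
    is contained in [L `\ z], contradicting [#|L| <= #|C|]. *)
Lemma slice0_le S b d p q C L :
    q \in S -> (forall i, i \in S -> i <= q) ->
    p \in S :\ q -> (forall i, i \in S :\ q -> i <= p) -> 2 < #|S| ->
    (forall l, l \in S -> compress S b d l C = C) ->
    C `<=` cell S b d -> initial (cell S b d) L -> #|` L| <= #|` C| ->
  #|` slice q L 0| <= #|` slice q C 0|.
Proof.
move=> qS qmax pSq pmax S3 fixC CA iL leLC; rewrite leqNgt; apply/negP => lt.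
have [pq pS] : p < q /\ p \in S.
  move: pSq; rewrite !inE => /andP[npq pS]; split=> //.
  by rewrite ltn_neqAle qmax // andbT.
pose A0 := cell (S :\ q) (setcoord b q 0) d.
have iC0 : initial A0 (slice q C 0).
  by rewrite -{1}(fixC q qS); apply: slice_compress_initial.
have iL0 : initial A0 (slice q L 0) by apply: slice_initial.
have [z zL0 zC0] : exists2 z, z \in slice q L 0 & z \notin slice q C 0.
  have : ~~ (slice q L 0 `<=` slice q C 0).
    by apply: contraL lt => /fsubset_leq_card; rewrite leqNgt.
  by case/fsubsetPn => z ? ?; exists z.
have zA0 : z \in A0 by case: iL0 => /fsubsetP/(_ _ zL0).
have [l /andP[lp lq] lS] : exists2 l, (l != p) && (l != q) & l \in S.
  have : 0 < #|S :\ q :\ p|.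
    by move: S3; rewrite (cardsD1 q S) qS (cardsD1 p) pSq.
  case/card_gt0P => l; rewrite !inE => /and3P[lp lq lS].
  by exists l => //; rewrite lp.
suff sub : C `<=` L `\ z.
  have zL : z \in L by move: zL0; rewrite in_fibre => /andP[].
  have := leq_trans leLC (fsubset_leq_card sub).
  by rewrite (cardfsD1 z L) zL add1n ltnn.
apply/fsubsetP => y yC; have yA := fsubsetP CA _ yC; have /cellP[dy ay] := yA.
have [y' [dy' ey' y'q yy']] := move_exponent y pq.
have y'A : y' \in cell S b d.
  apply/cellP; split; first by rewrite dy'.
  by move=> i iS; rewrite ey' ?ay //; apply: contraNneq iS => ->.
have y'C : y' \in C.
  by apply: (compress_fixed lS (fixC l lS) yC y'A _ yy'); rewrite ey'.
have y'C0 : y' \in slice q C 0 by rewrite in_fibre y'C y'q.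
have zy' : (z < y')%O.
  rewrite ltNge; apply: contra zC0 => y'z.
  by case: iC0 => _ /(_ y' z y'C0 zA0 y'z).
have /cellP[dz az] := zA0.
have /cellP[dy0 ay0] : y' \in A0 by case: iC0 => /fsubsetP/(_ _ y'C0).
have dzy' : mdeg z = mdeg y' by rewrite dz.
have azy' : agree_off (S :\ q) z y' by move=> i iS; rewrite az ?ay0.
have [i [iS eqi lti]] := ltmc_onP dzy' azy' zy'.
have ip : i < p.
  rewrite ltn_neqAle pmax // andbT; apply/eqP => /val_inj e; subst i.
  suff e : z = y' by rewrite e ltxx in zy'.
  apply: leq_mdeg => // k; have [kp|pk|/val_inj -> //] := ltngtP k p.
  - by rewrite eqi.
  - by rewrite azy' //; apply/negP => /pmax; rewrite leqNgt pk.
  - exact: ltnW.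
have ey i' : i' < p -> y' i' = y i'.
  move=> kp; apply: ey'.
    by apply/eqP => e; rewrite e ltnn in kp.
  by apply/eqP => e; rewrite e ltnNge (ltnW pq) in kp.
have zy : (z < y)%O.
  apply: (ltmc_le (i := i)); first by rewrite dz dy.
    by move=> k ki; rewrite eqi // ey ?(ltn_trans ki).
  by rewrite -ey.
rewrite in_fsetD1; apply/andP; split.
  by apply/eqP => e; rewrite e ltxx in zy.
case: iL => _; apply; last exact: ltW zy; last by [].
by move: zL0; rewrite in_fibre => /andP[].
Qed.

(** For one variable the slices of exponent 0 have empty shadows, for two
    variables [L_0] has a shadow of at most one element and [shadow_grows]
    applies; from three variables on, compress until nothing changes. *)
Theorem macaulay S : macaulay_at S.
Proof.
have [n] := ubnP #|S|; elim: n S => // n IHn S /ltnSE Sn b d C L CA iL leLC.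
have [S0|/set_maximum[q qS qmax]] := eqVneq S set0.
  suff -> : shadow S L = fset0 by rewrite cardfs0.
  apply/fsetP => x; rewrite in_fset0; apply/negP => /shadowP[y _ [i]].
  by rewrite S0 inE.
have cSq := cardsD1 q S; rewrite qS add1n in cSq.
have [S0|/set_maximum[p pSq pmax]] := eqVneq (S :\ q) set0.
  apply: leq_trans (shadow_upper qS qmax iL) _.
  apply: leq_trans (shadow_lower C qS).
  suff -> : shadow (S :\ q) (slice q L 0) = fset0 by rewrite cardfs0; lia.
  apply/fsetP => x; rewrite in_fset0; apply/negP => /shadowP[y _ [i]].
  by rewrite S0 inE.
have [pq pS] : p < q /\ p \in S.
  move: pSq; rewrite !inE => /andP[npq pS]; split=> //.
  by rewrite ltn_neqAle qmax // andbT.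
have Lc : L `<=` cell S b d by case: iL.
have [S2|S3] := leqP #|S| 2.
  have [L0|L0] := eqVneq L fset0.
    suff -> : shadow S L = fset0 by rewrite cardfs0.
    apply/fsetP => x; rewrite in_fset0; apply/negP => /shadowP[y].
    by rewrite L0 in_fset0.
  apply: leq_trans (shadow_upper qS qmax iL) _.
  have C0 : C != fset0 by rewrite -cardfs_gt0 (leq_trans _ leLC) // cardfs_gt0.
  apply: leq_trans (shadow_grows pS qS pq C0).
  rewrite -addn1; apply: leq_add => //.
  apply: leq_trans (fsubset_leq_card (shadow_sub (slice_sub 0 qS Lc))) _.
  by apply: cell_small; rewrite -ltnS -cSq.
pose A := cell S b d.
have [k] := ubnP (\sum_(x <- C) rank A x).
elim: k C CA leLC => // k IHk C CA leLC /ltnSE wC.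
have [/forall_inP fixC|/forall_inPn[l lS ne]] :=
    boolP [forall (l | l \in S), compress S b d l C == C].
  apply: leq_trans (shadow_upper qS qmax iL) _.
  apply: leq_trans (shadow_lower C qS); apply: leq_add => //.
  apply: IHn; [by rewrite -cSq|exact: slice_sub CA|exact: slice_initial|].
  by apply: (slice0_le (p := p)) iL leLC => // l lS; apply/eqP/fixC.
have IHl : macaulay_at (S :\ l).
  by apply: IHn; move: Sn; rewrite (cardsD1 l S) lS.
have cC := card_compress lS CA.
apply: leq_trans (shadow_compress lS IHl CA).
apply: IHk; [exact: compress_sub|by rewrite cC|].
have := weight_compress lS CA; rewrite -/A.
suff : 0 < #|` compress S b d l C `\` C| by lia.
rewrite cardfs_gt0; apply: contra ne; rewrite fsetD_eq0 => sub.
by rewrite eqEfcard cC leqnn andbT.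
Qed.

(** Compare [C] with the initial segment [L] of its size, which contains [V]:
    the elements of [translate q (L `\` V)], where [q] is the last variable, are
    in the shadow of [L] but not in that of [V], since [y + U_(i) = u + U_(q)]
    with [y] in [V] would give [y <= u], hence [u] in [V]. *)
Lemma macaulay_excess S b d V C : S != set0 ->
    initial (cell S b d) V -> C `<=` cell S b d -> #|` V| <= #|` C| ->
  #|` shadow S V| + #|` C| <= #|` shadow S C| + #|` V|.
Proof.
move=> /set_maximum[q qS qmax] iV CA leVC.
pose L := top (cell S b d) #|` C|.
have iL : initial (cell S b d) L by apply: top_initial.
have cL : #|` L| = #|` C| by rewrite card_top // fsubset_leq_card.
have VL : V `<=` L by apply: initial_total iV iL _; rewrite cL.
have leLC : #|` shadow S L| <= #|` shadow S C|.
  by apply: macaulay CA iL _; rewrite cL.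
suff : #|` shadow S V| + #|` translate q (L `\` V)| <= #|` shadow S L|.
  rewrite card_translate cardfsDS // cL => le.
  by rewrite -(subnK leVC) addnA leq_add2r (leq_trans le).
rewrite -cardfsUI.
have -> : shadow S V `&` translate q (L `\` V) = fset0.
  apply/fsetP => x; rewrite in_fset0 in_fsetI.
  apply/negP => /andP[/shadowP[y yV [i iS ey]]].
  case/imfsetP => u /=; rewrite in_fsetD => /andP[/negP uV uL] eu; apply: uV.
  case: iV => _ /(_ y u yV); apply.
    by case: iL => /fsubsetP/(_ u uL).
  have := mnm_shift_le y (qmax i iS).
  by rewrite -[(y + U_(i))%MM]ey eu ![(_ + U_(q))%MM]addmC lemc_add2r.
rewrite cardfs0 addn0; apply: fsubset_leq_card; apply/fsubsetP => x.
rewrite in_fsetU => /orP[/(fsubsetP (shadowS S VL)) //|/imfsetP[y /= yL ->]].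
apply/shadowP; exists y; last by exists q.
by move: yL; rewrite in_fsetD => /andP[].
Qed.

End Monomials.

(** * Ideals generated by antichains, degree by degree *)

Section Ideals.
Variable m : nat.
Hypothesis m_gt0 : 0 < m.
Implicit Types (W U V : {fset 'X_{1..m}}) (x y : 'X_{1..m}) (d : nat).

Definition layer d : {fset 'X_{1..m}} := cell [set: 'I_m] 0%MM d.

Lemma in_layer d x : (x \in layer d) = (mdeg x == d).
Proof.
apply/cellP/eqP => [[]//|dx]; split=> // i; by rewrite inE.
Qed.

(** The degree [d] part of the monomial ideal generated by [W]. *)
Definition ideal_layer W d : {fset 'X_{1..m}} :=
  [fset x in layer d | has (fun y => (y <= x)%MM) W].

Lemma ideal_layerP W d x :
  reflect (mdeg x = d /\ exists2 y, y \in W & (y <= x)%MM)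
          (x \in ideal_layer W d).
Proof.
have -> : (x \in ideal_layer W d) =
    (mdeg x == d) && has (fun y => (y <= x)%MM) W by rewrite -in_layer in_fset.
apply: (iffP andP) => [[/eqP dx /hasP[y]]|[-> [y]]].
  by split=> //; exists y.
by move=> yW yx; rewrite eqxx; split=> //; apply/hasP; exists y.
Qed.

Lemma ideal_layer_sub W d : ideal_layer W d `<=` layer d.
Proof. by apply/fsubsetP => x /ideal_layerP[/eqP]; rewrite in_layer. Qed.

Definition upto W d : {fset 'X_{1..m}} := [fset x in W | mdeg x <= d].

Lemma in_upto W d x : (x \in upto W d) = (x \in W) && (mdeg x <= d).
Proof. by rewrite in_fset. Qed.

Lemma lepm_mdeg x y : (x <= y)%MM -> mdeg x <= mdeg y.
Proof. by move/mnm_lepP => le; rewrite !mdegE; apply: leq_sum. Qed.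

Lemma lepm_mdeg_eq x y : (x <= y)%MM -> mdeg y <= mdeg x -> x = y.
Proof.
move=> le dyx; apply: leq_mdeg; first exact/mnm_lepP.
by apply/eqP; rewrite eqn_leq dyx lepm_mdeg.
Qed.

Lemma ideal_layer0 W : ideal_layer W 0 = upto W 0.
Proof.
apply/fsetP => x; rewrite in_upto; apply/ideal_layerP/andP.
  case=> dx [y yW yx].
  have -> : x = y by apply/esym/lepm_mdeg_eq; rewrite // dx.
  by split=> //; rewrite -dx lepm_mdeg.
case=> xW; rewrite leqn0 => /eqP dx; split=> //.
by exists x => //; exact: lepm_refl.
Qed.

Lemma ideal_layerS W d :
  ideal_layer W d.+1 = shadow setT (ideal_layer W d) `|` fibre (@mdeg m) W d.+1.
Proof.
apply/fsetP => x; rewrite in_fsetU in_fibre; apply/ideal_layerP/orP.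
  case=> dx [y yW yx]; have := lepm_mdeg yx; rewrite dx leq_eqVlt.
  case/predU1P => [dy|dy].
    by right; rewrite -(lepm_mdeg_eq yx) ?dx ?dy // yW eqxx.
  left; have [i yi] : exists i, y i < x i.
    apply/existsP; rewrite -[[exists _, _]]negbK negb_exists.
    apply/negP => /forallP h; have : mdeg x <= mdeg y.
      by rewrite !mdegE; apply: leq_sum => i _; rewrite leqNgt.
    by rewrite dx leqNgt dy.
  have [u eu] := mnm_subK (leq_ltn_trans (leq0n _) yi).
  apply/shadowP; exists u; last by exists i; rewrite // inE.
  apply/ideal_layerP; split; first by move: dx; rewrite eu mdegD1 => -[].
  exists y => //; apply/mnm_lepP => k; have := mnm_lepP yx k; move: yi.
  rewrite eu !mnmD1 eqxx.
  by case: (eqVneq i k) => [->|_]; rewrite ?addn1 ?ltnS ?addn0.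
case=> [/shadowP[u /ideal_layerP[du [y yW yu]] [i _ ->]]|/andP[xW /eqP dx]].
  split; first by rewrite mdegD1 du.
  by exists y => //; apply: lepm_trans yu _; apply: lem_addr.
by split=> //; exists x => //; exact: lepm_refl.
Qed.

Lemma upto_succ W d :
  #|` upto W d.+1| = #|` upto W d| + #|` fibre (@mdeg m) W d.+1|.
Proof.
have -> : upto W d.+1 = upto W d `|` fibre (@mdeg m) W d.+1.
  apply/fsetP => x; rewrite in_fsetU in_fibre !in_upto -andb_orr.
  by rewrite leq_eqVlt orbC ltnS.
rewrite -cardfsUI; have -> : upto W d `&` fibre (@mdeg m) W d.+1 = fset0.
  apply/fsetP => x; rewrite in_fset0 in_fsetI in_fibre in_upto.
  by apply/negP => /andP[/andP[_ le] /andP[_ /eqP e]]; rewrite e ltnn in le.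
by rewrite cardfs0 addn0.
Qed.

(** The antichain condition on [U] makes the shadow of its ideal disjoint from
    the generators of the next degree, so the count for [U] is exact where the
    one for [V] is an upper bound.  The surplus
    [#|upto U d| - #|upto V d|], which is nonnegative, is carried from one
    degree to the next by [macaulay_excess]. *)
Lemma ideal_growth U V :
    {in U &, forall x y, (x <= y)%MM -> x = y} ->
    (forall d, initial (layer d) (ideal_layer V d)) ->
    (forall d, #|` upto V d| <= #|` upto U d|) -> forall d,
  #|` ideal_layer V d| + #|` upto U d| <= #|` ideal_layer U d| + #|` upto V d|.
Proof.
move=> acU iV le; elim=> [|d IH]; first by rewrite !ideal_layer0 addnC.
have sub : ideal_layer U d `<=` layer d := ideal_layer_sub U d.
have leVU : #|` ideal_layer V d| <= #|` ideal_layer U d|.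
  by rewrite -(leq_add2r (#|` upto V d|)) (leq_trans _ IH) // leq_add2l.
have T0 : [set: 'I_m] != set0.
  by apply/set0Pn; exists (Ordinal m_gt0); rewrite inE.
have gr := macaulay_excess T0 (iV d) sub leVU.
have eU : #|` ideal_layer U d.+1| =
    #|` shadow setT (ideal_layer U d)| + #|` fibre (@mdeg m) U d.+1|.
  rewrite ideal_layerS -cardfsUI.
  have -> : shadow setT (ideal_layer U d) `&` fibre (@mdeg m) U d.+1 = fset0.
    apply/fsetP => x; rewrite in_fset0 in_fsetI in_fibre.
    apply/negP => /andP[/shadowP[u /ideal_layerP[du [y yU yu]] [i _ ex]]].
    case/andP=> xU _; have yx : (y <= x)%MM.
      by rewrite ex; apply: lepm_trans yu _; apply: lem_addr.
    have := lepm_mdeg yu; rewrite (acU _ _ yU xU yx) ex mdegD1.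
    by rewrite ltnn.
  by rewrite cardfs0 addn0.
have eV : #|` ideal_layer V d.+1| <=
    #|` shadow setT (ideal_layer V d)| + #|` fibre (@mdeg m) V d.+1|.
  by rewrite ideal_layerS cardfsU leq_subr.
rewrite eU !upto_succ; move: eV gr IH.
move: #|` _| #|` _| #|` _| #|` _| #|` _| #|` _| #|` _| #|` _| #|` _| .
move=> *; lia.
Qed.

End Ideals.

(** * Dickson's lemma *)

Section Dickson.

(** Repeatedly choose an index at which [h] is minimal among all later
    indices. *)
Lemma nondecreasing_subseq (h : nat -> nat) :
  exists2 phi : nat -> nat, {homo phi : i j / i < j} &
    {homo h \o phi : i j / i <= j}.
Proof.
have argmin N : exists i, N <= i /\ forall j, N <= j -> h i <= h j.
  suff: forall v i, N <= i -> h i <= v ->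
      exists i, N <= i /\ forall j, N <= j -> h i <= h j.
    by move=> /(_ (h N) N (leqnn N) (leqnn _)).
  elim=> [|v IH] i Ni hi.
    by exists i; split=> // j _; move: hi; rewrite leqn0 => /eqP ->.
  case: (classic (exists2 j, N <= j & h j <= v)) => [[j Nj hj]|nex].
    exact: IH Nj hj.
  exists i; split=> // j Nj; apply: leq_trans hi _; rewrite ltnNge.
  by apply/negP => hj; apply: nex; exists j.
pose F N := proj1_sig (constructive_indefinite_description _ (argmin N)).
have FP N : N <= F N /\ forall j, N <= j -> h (F N) <= h j.
  exact: proj2_sig (constructive_indefinite_description _ (argmin N)).
pose phi := fix phi n := if n is k.+1 then F (phi k).+1 else F 0.
have phiS n : phi n.+1 = F (phi n).+1 by [].
have phi_lt n : phi n < phi n.+1 by case: (FP (phi n).+1).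
exists phi; first by apply: homo_ltn; [exact: ltn_trans|exact: phi_lt].
apply: homo_leq; [by []|exact: leq_trans|move=> n /=].
case: n => [|n]; first by have [_] := FP 0; apply.
have [le mn] := FP (phi n).+1; rewrite {1}phiS; apply: mn.
exact: leq_trans le (ltnW (phi_lt n.+1)).
Qed.

(** Pass to subsequences nondecreasing in one coordinate after another. *)
Lemma dickson m (g : nat -> 'X_{1..m}) :
  exists i j, i < j /\ (g i <= g j)%MM.
Proof.
suff [phi phi_lt phi_le] : exists2 phi : nat -> nat, {homo phi : i j / i < j} &
    forall c, c \in enum 'I_m -> {homo (fun n => g (phi n) c) : i j / i <= j}.
  exists (phi 0), (phi 1); split; first exact: phi_lt.
  by apply/mnm_lepP => c; apply: (phi_le c); rewrite ?mem_enum.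
elim: (enum 'I_m) => [|c r [phi phi_lt phi_le]]; first by exists id.
have [psi psi_lt psi_le] := nondecreasing_subseq (fun n => g (phi n) c).
exists (phi \o psi) => [i j /psi_lt/phi_lt //|c'].
rewrite inE => /predU1P[-> |c'r]; first exact: psi_le.
move=> i j ij; apply: (phi_le c' c'r).
have psi_le' : {homo psi : i j / i <= j} by apply: ltnW_homo.
exact: psi_le'.
Qed.

End Dickson.

(** * The greedy sequence *)

Section MuBar.
Variables (m : nat) (f : nat -> nat).
Hypotheses (m_gt0 : 0 < m) (f_incr : {homo f : i j / i <= j}).
Implicit Types (mu s : seq 'X_{1..m}) (x : 'X_{1..m}).

Definition candidates mu : {fset 'X_{1..m}} :=
  [fset x in layer m (f (size mu).+1) | all (fun y => ~~ (y <= x)%MM) mu].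

Lemma candidatesP mu x :
  reflect (candidate f mu (size mu) x) (x \in candidates mu).
Proof.
have -> : (x \in candidates mu) = (mdeg x == f (size mu).+1) &&
    all (fun y => ~~ (y <= x)%MM) mu by rewrite -in_layer in_fset.
apply: (iffP andP) => [[/eqP dx /(all_nthP 0%MM) h]|[-> h]] //.
by split=> //; apply/(all_nthP 0%MM).
Qed.

(** The recursion run for [n] steps, past its end if need be; entries beyond the
    end are junk.  The sequence sought is the prefix of the first length [n] at
    which no candidate is left. *)
Definition prefix n : seq 'X_{1..m} :=
  iter n (fun mu => rcons mu (greatest (candidates mu))) [::].

Lemma size_prefix n : size (prefix n) = n.
Proof. by elim: n => //= n IH; rewrite size_rcons IH. Qed.

Lemma nth_prefix n i : i < n ->
  nth 0%MM (prefix n) i = greatest (candidates (prefix i)).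
Proof.
elim: n => // n IH; rewrite ltnS leq_eqVlt /= nth_rcons size_prefix.
by case/predU1P => [->|lt]; [rewrite ltnn eqxx|rewrite lt IH].
Qed.

Lemma candidate_ext mu mu' i x :
    (forall j, j < i -> nth 0%MM mu j = nth 0%MM mu' j) ->
  candidate f mu i x -> candidate f mu' i x.
Proof. by move=> e [dx h]; split=> // j ji; rewrite -e ?h. Qed.

(** If candidates never ran out, the entries would violate Dickson's lemma. *)
Lemma mu_bar_exists : exists mu, is_mu_bar f mu (m := m).
Proof.
have stop : exists n, candidates (prefix n) == fset0.
  have [i [j [ij le]]] := dickson (fun n => greatest (candidates (prefix n))).
  exists j; apply: contraLR le => /greatestP[/candidatesP[_]].
  by rewrite size_prefix => /(_ i ij); rewrite nth_prefix.
case: (ex_minnP stop) => n /eqP cn nmin; exists (prefix n).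
rewrite /is_mu_bar size_prefix; split=> [i ni|[x cx]]; last first.
  suff : x \in candidates (prefix n) by rewrite cn in_fset0.
  by apply/candidatesP; rewrite size_prefix.
have c0 : candidates (prefix i) != fset0.
  by apply/negP => /nmin; rewrite leqNgt ni.
have candE x : candidate f (prefix n) i x <-> x \in candidates (prefix i).
  have e j : j < i -> nth 0%MM (prefix n) j = nth 0%MM (prefix i) j.
    by move=> ji; rewrite !nth_prefix // (ltn_trans ji).
  split=> [cx|/candidatesP]; first apply/candidatesP; rewrite size_prefix.
    exact: candidate_ext cx.
  by apply: candidate_ext => j /e.
have [gc gmax] := greatestP c0; rewrite nth_prefix //.
by split=> [|y /candE]; [apply/candE|exact: gmax].
Qed.

Lemma is_max_uniq (A A' : 'X_{1..m} -> Prop) x y :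
  (forall z, A z <-> A' z) -> is_max A x -> is_max A' y -> x = y.
Proof.
move=> AA' [Ax xmax] [A'y ymax]; apply/le_anti; rewrite ymax -?AA' //.
by rewrite xmax // AA'.
Qed.

Lemma mu_bar_agree mu mu' : is_mu_bar f mu -> is_mu_bar f mu' ->
  forall i, i < size mu -> i < size mu' -> nth 0%MM mu i = nth 0%MM mu' i.
Proof.
move=> [mx _] [mx' _] i; have [k] := ubnP i; elim: k i => // k IH i ik imu imu'.
have e j : j < i -> nth 0%MM mu j = nth 0%MM mu' j.
  by move=> ji; apply: IH; [exact: leq_trans ji _|exact: ltn_trans ji _..].
apply: is_max_uniq (mx i imu) (mx' i imu') => z.
by split; apply: candidate_ext => // j /e.
Qed.

Lemma mu_bar_size mu mu' : is_mu_bar f mu -> is_mu_bar f mu' -> 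
  size mu' <= size mu.
Proof.
move=> bmu bmu'; rewrite leqNgt; apply/negP => lt.
case: (bmu) => _; apply; exists (nth 0%MM mu' (size mu)).
case: (bmu') => /(_ _ lt) [c _] _; apply: candidate_ext c => j jmu.
by apply/esym/(mu_bar_agree bmu bmu') => //; apply: ltn_trans lt.
Qed.

Lemma mu_bar_uniq mu mu' : is_mu_bar f mu -> is_mu_bar f mu' -> mu = mu'.
Proof.
move=> bmu bmu'; have e : size mu = size mu'.
  by apply/eqP; rewrite eqn_leq !mu_bar_size.
by apply: (@eq_from_nth _ 0%MM) => // i imu; apply: mu_bar_agree; rewrite -?e.
Qed.

Section Fixed.
Variable mu : seq 'X_{1..m}.
Hypothesis bmu : is_mu_bar f mu.

Lemma mdeg_mu_bar i : i < size mu -> mdeg (nth 0%MM mu i) = f i.+1.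
Proof. by case: bmu => mx _ /mx [[]]. Qed.

(** An earlier entry never divides a later one, by construction.  A later entry
    has at least the degree of an earlier one, so it could divide it only by
    being equal to it. *)
Lemma mu_bar_bounded_antichain : bounded_antichain f mu.
Proof.
case: bmu => mx _; split=> [i j imu jmu ij|i imu]; last by rewrite mdeg_mu_bar.
have [lt|gt|/eqP] := ltngtP i j; last by rewrite (negbTE ij).
  by case: (mx j jmu) => [[_ /(_ i lt)]].
apply/negP => le; have e : nth 0%MM mu i = nth 0%MM mu j.
  by apply: lepm_mdeg_eq le _; rewrite !mdeg_mu_bar // f_incr // ltnW.
by case: (mx i imu) => [[_ /(_ j gt)]]; rewrite e lepm_refl.
Qed.

Let W : {fset 'X_{1..m}} := [fset x in mu].

(** In degree [d.+1] the ideal consists of a shadow, initial by induction, and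
    of new entries of [mu].  A monomial [y] of that degree above a new entry
    [x] was not a candidate when [x] was selected, so an entry before [x]
    divides [y]. *)
Lemma mu_bar_ideal_initial d : initial (layer m d) (ideal_layer W d).
Proof.
elim: d => [|d IH]; split; try exact: ideal_layer_sub.
  move=> x y xi; rewrite in_layer mdeg_eq0 => /eqP -> _.
  by have /ideal_layerP[/eqP + _] := xi; rewrite mdeg_eq0 => /eqP <-.
move=> x y; rewrite [in X in X -> _]ideal_layerS in_fsetU => /orP[xs|xW] yl xy.
  rewrite ideal_layerS in_fsetU; apply/orP; left.
  by case: (shadow_initial IH) => _; apply; first exact: xs.
move: xW; rewrite in_fibre in_fset => /andP[xmu /eqP dx].
have dy : mdeg y = d.+1 by apply/eqP; rewrite -in_layer.
have imu : index x mu < size mu by rewrite index_mem.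
have ex : nth 0%MM mu (index x mu) = x by rewrite nth_index.
have [yx|] := leP y x.
  have -> : y = x by apply/le_anti; rewrite yx xy.
  by apply/ideal_layerP; split=> //; exists x; rewrite ?in_fset // lepm_refl.
rewrite -ex => xy'; apply/ideal_layerP; split=> //.
have : has (fun z => (z <= y)%MM) (take (index x mu) mu).
  apply: contraT => /hasPn nh; case: bmu => /(_ _ imu) [_ mx] _.
  have : (y <= nth 0%MM mu (index x mu))%O.
    apply: mx; split; first by rewrite -mdeg_mu_bar // ex dx.
    move=> j ji; apply: nh; rewrite -(nth_take 0%MM ji) mem_nth //.
    by rewrite size_take imu.
  by rewrite leNgt xy'.
by case/hasP => z /mem_take zmu zy; exists z; rewrite // in_fset.
Qed.

Lemma mu_bar_ideal_full :
  ideal_layer W (f (size mu).+1) = layer m (f (size mu).+1).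
Proof.
apply/eqP; rewrite eqEfsubset ideal_layer_sub /=; apply/fsubsetP => x.
rewrite in_layer => /eqP dx; apply/ideal_layerP; split=> //.
have : has (fun y => (y <= x)%MM) mu.
  apply: contraT => /hasPn nh; case: bmu => _ []; exists x; split=> // j jmu.
  by apply: nh; rewrite mem_nth.
by case/hasP => y ymu yx; exists y; rewrite // in_fset.
Qed.

(** The [(size mu).+1] entries of [s] retained in [U] all have degree at most
    [f (size mu).+1], the degree in which the ideal generated by [mu] is
    everything. *)
Lemma mu_bar_maximal s : bounded_antichain f s -> size s <= size mu.
Proof.
case=> acs degs; rewrite leqNgt; apply/negP => lt; set L := size mu in lt.
pose J : {fset nat} := [fset i in iota 0 L.+1].
have JE i : (i \in J) = (i <= L) by rewrite in_fset mem_iota ltnS.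
pose U : {fset 'X_{1..m}} := [fset nth 0%MM s i | i in J].
have nth_inj i j : i < size s -> j < size s ->
    (nth 0%MM s i <= nth 0%MM s j)%MM -> i = j.
  by move=> si sj le; apply/eqP; apply: contraLR le; apply: acs.
have acU : {in U &, forall x y, (x <= y)%MM -> x = y}.
  move=> _ _ /imfsetP[i /= + ->] /imfsetP[j /= + ->] le.
  rewrite !JE => iL jL; congr nth.
  by apply: nth_inj le; [exact: leq_ltn_trans iL lt|exact: leq_ltn_trans jL lt].
have cardU (I : {fset nat}) : (forall i, i \in I -> i <= L) ->
    #|` [fset nth 0%MM s i | i in I]| = #|` I|.
  move=> IL; rewrite card_in_imfset // => i j /IL iL /IL jL e.
  by apply: nth_inj; rewrite ?e ?lepm_refl // (leq_ltn_trans _ lt).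
have le d : #|` upto W d| <= #|` upto U d|.
  pose I : {fset nat} := [fset i in iota 0 L | f i.+1 <= d].
  have IE i : (i \in I) = (i \in iota 0 L) && (f i.+1 <= d) by rewrite in_fset.
  have IL i : i \in I -> i < L /\ f i.+1 <= d.
    by rewrite IE mem_iota => /andP[/andP[_ ->] ->].
  have WI : upto W d `<=` [fset nth 0%MM mu i | i in I].
    apply/fsubsetP => x; rewrite in_upto in_fset => /andP[xmu dx].
    have imu : index x mu < size mu by rewrite index_mem.
    apply/imfsetP; exists (index x mu) => /=; last by rewrite nth_index.
    by rewrite IE mem_iota /= imu -mdeg_mu_bar // nth_index.
  have IU : [fset nth 0%MM s i | i in I] `<=` upto U d.
    apply/fsubsetP => _ /imfsetP[i /= /IL [iL fi] ->]; rewrite in_upto.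
    apply/andP; split; first by apply/imfsetP; exists i; rewrite //= JE ltnW.
    by apply: leq_trans (degs i _) fi; apply: ltn_trans lt.
  apply: leq_trans (fsubset_leq_card WI) _.
  apply: leq_trans (leq_imfset_card _ _ _) _.
  apply: leq_trans (fsubset_leq_card IU); rewrite cardU // => i /IL[/ltnW].
  by [].
have := ideal_growth m_gt0 acU mu_bar_ideal_initial le (f L.+1).
rewrite mu_bar_ideal_full -/L.
have -> : upto U (f L.+1) = U.
  apply/fsetP => x; rewrite in_upto; apply: andb_idr => /imfsetP[i /=].
  rewrite JE => iL ->.
  by apply: leq_trans (degs i _) _; [exact: leq_ltn_trans iL lt|apply: f_incr].
have -> : #|` U| = L.+1.
  rewrite /U cardU => [|i]; last by rewrite JE.
  by rewrite card_fseq undup_id ?iota_uniq // size_iota.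
have leW : #|` upto W (f L.+1)| <= L.
  apply: leq_trans (_ : #|` W| <= L).
    by apply: fsubset_leq_card; apply: fset_sub.
  by rewrite card_fseq size_undup.
have leU := fsubset_leq_card (ideal_layer_sub U (f L.+1)).
move/leq_trans/(_ (leq_add leU leW)); by rewrite leq_add2l ltnn.
Qed.

End Fixed.
End MuBar.

Theorem theorem3p9 (m : nat) (f : nat -> nat) (m_gt0 : 0 < m)
    (f_incr : {homo f : i j / i <= j}) :
  (exists! mu : seq 'X_{1..m}, is_mu_bar f mu) /\
  (forall mu : seq 'X_{1..m}, is_mu_bar f mu ->
     [/\ bounded_antichain f mu,
         forall s : seq 'X_{1..m}, bounded_antichain f s -> size s <= size mu
       & is_max_antichain_length m f (size mu)]).
Proof.
split.
  have [mu bmu] := mu_bar_exists m f; exists mu; split=> // mu'.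
  exact: mu_bar_uniq.
move=> mu bmu; have ac := mu_bar_bounded_antichain f_incr bmu.
have mx := mu_bar_maximal m_gt0 f_incr bmu.
split=> //; split; first by exists mu.
by move=> _ [s bs <-]; rewrite leEnat; apply: mx.
Qed.
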